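(* Every linear $\mathrm{Datalog}^\circ$ program over a $p$-stable commutative semiring that contains $L$ elements in its ground set converges in $O(pn\log L)$ steps, where $n$ is the total number of ground IDB atoms. Precisely: there is an absolute constant $C>0$ such that for all integers $n\ge 1$, $p\ge 1$, $L\geq 1$, every $p$-stable commutative semiring $(S,+,\cdot,0,1)$ with $|S|=L$, every matrix $A\in S^{n\times n}$ and every vector $b\in S^n$, the map $f:S^n\to S^n$, $f(x)=Ax+b$, satisfies $f^{(q+1)}(\mathbf 0)=f^{(q)}(\mathbf 0)$ for some integer $0\le q\le C\,p\,n\log L$.
   Context: A commutative semiring $(S,+,\cdot,0,1)$ has $(S,+,0)$ and $(S,\cdot,1)$ commutative monoids, $\cdot$ distributing over $+$, and $a\cdot 0=0$ for all $a\in S$ (the one-element semiring with $0=1$ is allowed). For $u\in S$ put $u^{(p)}:=1+u+u^2+\cdots+u^p$. The element $u$ is $p$-stable if $u^{(p)}=u^{(p+1)}$; the semiring is $p$-stable if every $u\in S$ is $p$-stable. A linear $\mathrm{Datalog}^\circ$ program over $S$ with $n$ ground IDB atoms has, once grounded, an immediate consequence operator of the form $f:S^n\to S^n$, $f(x)=Ax+b$, with $A\in S^{n\times n}$ and $b\in S^n$ (matrix operations computed in $S$). Naive evaluation starts at the all-zero vector $\mathbf 0\in S^n$ and repeatedly applies $f$; $f^{(q)}$ denotes the $q$-fold composition of $f$ with itself ($f^{(0)}$ is the identity). The convergence rate (number of steps to converge) is the smallest $q$ with $f^{(q+1)}(\mathbf 0)=f^{(q)}(\mathbf 0)$. *)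

(* Defs.v *)
From HB Require Import structures.
From mathcomp Require Import all_boot all_order all_algebra.
From mathcomp Require Import reals exp.

Set Implicit Arguments.
Unset Strict Implicit.
Unset Printing Implicit Defensive.

Import GRing.Theory.
Local Open Scope ring_scope.

(* The semirings are possibly zero (Pz) ones: 0 = 1 is allowed. *)

(* u^(p) = 1 + u + ... + u^p, that is, p + 1 terms. *)
Definition geom_sum (S : comPzSemiRingType) (p : nat) (u : S) : S :=
  \sum_(i < p.+1) u ^+ i.

Definition stable_elt (S : comPzSemiRingType) (p : nat) (u : S) : Prop :=
  geom_sum p u = geom_sum p.+1 u.

Definition stable_semiring (S : comPzSemiRingType) (p : nat) : Prop :=
  forall u : S, stable_elt p u.

(* A linear program with n ground IDB atoms, once grounded, acts on the column
   of their values by x |-> A x + b; naive evaluation iterates this from 0. *)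
Definition consequence_op (S : comPzSemiRingType) (n : nat)
    (A : 'M[S]_n) (b : 'cV[S]_n) (x : 'cV[S]_n) : 'cV[S]_n :=
  A *m x + b.

Definition naive_eval (S : comPzSemiRingType) (n : nat)
    (A : 'M[S]_n) (b : 'cV[S]_n) (q : nat) : 'cV[S]_n :=
  iter q (consequence_op A b) 0.

(* Main.v *)
(* Coordinate i of f^(q)(0) sums the weights of the walks of length < q from i,
   so it suffices that every walk of length q = nN is absorbed by the shorter
   ones.  Such a walk visits some vertex N + 1 times, hence it is P c_1 ... c_N Q
   with closed walks c_k at a common vertex; by commutativity each vector e of
   exponents gives a walk of weight a * prod_k c_k^(e_k).  Take 2^m > L and
   N = 2(p + 1)m.  If at least m exponents are nonzero, two distinct sets X, Y
   among m of them have equal products, and exchanging X and Y preserves the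
   weight.  If this shortens the walk p + 1 times, then p + 1 shorter walks of
   different lengths have the same weight w, and (p + 1)w absorbs w (stability of
   1).  Otherwise the exchanges end with fewer than m nonzero exponents, one of
   which exceeds p, and stability of that c_k applies.  Keeping only one walk of
   each length avoids any comparison of walks. *)

Require Import Defs.
From HB Require Import structures.
From mathcomp Require Import all_boot all_order all_algebra.
From mathcomp Require Import reals exp.
From mathcomp Require Import zify lra.

Set Implicit Arguments.
Unset Strict Implicit.
Unset Printing Implicit Defensive.

Import Order.TTheory GRing.Theory Num.Theory.
Local Open Scope ring_scope.

(** * Lexicographic induction and subsets of prescribed size *)

Lemma lex_ind3 (T : Type) (f g h : T -> nat) (P : T -> Prop) :
  (forall x, (forall y, (f y < f x)%N \/ f y = f x /\
     ((g y < g x)%N \/ g y = g x /\ (h y < h x)%N) -> P y) -> P x) ->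
  forall x, P x.
Proof.
move=> IH x.
have [k le_k] := ubnP (f x); elim: k => // k IHf in x le_k *.
have [i le_i] := ubnP (g x); elim: i => // i IHg in x le_k le_i *.
have [j le_j] := ubnP (h x); elim: j => // j IHh in x le_k le_i le_j *.
apply: IH => y [lt_f|[eq_f [lt_g|[eq_g lt_h]]]].
- by apply: IHf; lia.
- by apply: IHg; lia.
- by apply: IHh; lia.
Qed.

Lemma exists_subset_card (T : finType) (A : {set T}) (m : nat) :
  (m <= #|A|)%N -> exists2 B : {set T}, B \subset A & #|B| = m.
Proof.
move=> le_m; exists [set x in take m (enum A)].
  by apply/subsetP=> x; rewrite inE => /mem_take; rewrite mem_enum.
rewrite cardsE (card_uniqP _) ?take_uniq ?enum_uniq //.
by rewrite size_takel // -cardE.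
Qed.

(** * The natural preorder and absorption *)

Section NaturalOrder.
Variable S : comPzSemiRingType.
Implicit Types x y z u : S.

Definition natural_le x y := exists z, y = x + z.

Definition absorbs x u := x + u = x.

Lemma natural_le_refl x : natural_le x x.
Proof. by exists 0; rewrite addr0. Qed.

Lemma natural_le_trans y x z :
  natural_le x y -> natural_le y z -> natural_le x z.
Proof. by case=> s -> [t ->]; exists (s + t); rewrite addrA. Qed.

Lemma natural_leD x y u v :
  natural_le x y -> natural_le u v -> natural_le (x + u) (y + v).
Proof. by case=> s -> [t ->]; exists (s + t); rewrite addrACA. Qed.

Lemma natural_leM a x y : natural_le x y -> natural_le (a * x) (a * y).
Proof. by case=> s ->; exists (a * s); rewrite mulrDr. Qed.

Lemma natural_le_sum (I : finType) (F : I -> S) i :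
  natural_le (F i) (\sum_j F j).
Proof. by rewrite (bigD1 i) //=; exists (\sum_(j | j != i) F j). Qed.

Lemma natural_le_sum_ord (F : nat -> S) a b :
  (a <= b)%N -> natural_le (\sum_(l < a) F l) (\sum_(l < b) F l).
Proof.
move/subnKC=> <-; rewrite big_split_ord /=.
by exists (\sum_(i < b - a) F (a + i)%N).
Qed.

Lemma absorbs_le x y u : natural_le x y -> absorbs x u -> absorbs y u.
Proof. by rewrite /absorbs => -[s ->]; rewrite addrAC => ->. Qed.

Lemma absorbs_sum (I : finType) (F : I -> S) x :
  (forall i, absorbs x (F i)) -> absorbs x (\sum_i F i).
Proof.
move=> absF; apply: (big_ind (absorbs x)) => //; first exact: addr0.
by rewrite /absorbs => u v xu xv; rewrite addrA xu.
Qed.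

Lemma absorbsM a x u : absorbs x u -> absorbs (a * x) (a * u).
Proof. by rewrite /absorbs -mulrDr => ->. Qed.

Lemma absorbs_geom_sum p u :
  stable_semiring S p -> absorbs (geom_sum p u) (u ^+ p.+1).
Proof. by move=> /(_ u); rewrite /stable_elt {2}/geom_sum big_ord_recr. Qed.

Lemma absorbs_natmul p u : stable_semiring S p -> absorbs (u *+ p.+1) u.
Proof.
move=> /(@absorbs_geom_sum p 1); rewrite expr1n /geom_sum.
under eq_bigr do rewrite expr1n.
by rewrite sumr_const card_ord => /(absorbsM u); rewrite mulr1 mulr_natr.
Qed.

End NaturalOrder.

(** * Exponent vectors and exchanges *)

Section Exponents.
Variable I : finType.
Implicit Types (e f : I -> nat) (X Y : {set I}) (k : I).

Definition weighted f e : nat := (\sum_k e k * f k)%N.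

Definition total e : nat := (\sum_k e k)%N.

Definition square_sum e : nat := (\sum_k e k ^ 2)%N.

(** The truncated subtraction is exact when [X] lies in the support of [e]. *)
Definition exchange X Y e k : nat := (e k - (k \in X) + (k \in Y))%N.

Definition support_set e : {set I} := [set k | 0 < e k]%N.

Lemma in_support e X k : X \subset support_set e -> ((k \in X) <= e k)%N.
Proof. by move=> /subsetP/(_ k); rewrite inE; case: (k \in X) => // ->. Qed.

Lemma weighted1 e : weighted (fun=> 1%N) e = total e.
Proof. by apply: eq_bigr => k _; rewrite muln1. Qed.

Lemma weighted_exchange f X Y e : X \subset support_set e ->
  (weighted f (exchange X Y e) + \sum_(k in X) f k =
   weighted f e + \sum_(k in Y) f k)%N.
Proof.
move=> sX; rewrite !(big_mkcond (fun k => k \in _)) /= -!big_split /=.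
apply: eq_bigr => k _; rewrite /exchange; have := in_support k sX.
by case: (k \in X); case: (k \in Y); nia.
Qed.

Lemma total_exchange X Y e : X \subset support_set e ->
  (total (exchange X Y e) + #|X| = total e + #|Y|)%N.
Proof.
by move=> sX; rewrite -!weighted1 -!sum1_card weighted_exchange.
Qed.

(* Strict convexity: [e] is the midpoint of its two exchanges. *)
Lemma square_sum_exchange X Y e :
    X \subset support_set e -> Y \subset support_set e -> X != Y ->
  (2 * square_sum e <
   square_sum (exchange X Y e) + square_sum (exchange Y X e))%N.
Proof.
move=> sX sY neqXY.
have [k neqk] : exists k, (k \in X) != (k \in Y).
  apply/existsP; apply: contraNT neqXY => /existsPn eqXY.
  by apply/eqP/setP=> k; apply/eqP; have := eqXY k; rewrite negbK.
have le_term j : (2 * e j ^ 2 <=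
    exchange X Y e j ^ 2 + exchange Y X e j ^ 2)%N.
  rewrite /exchange; have := in_support j sX; have := in_support j sY.
  by case: (j \in X); case: (j \in Y); nia.
have lt_term : (2 * e k ^ 2 <
    exchange X Y e k ^ 2 + exchange Y X e k ^ 2)%N.
  rewrite /exchange; have := in_support k sX; have := in_support k sY.
  by case: (k \in X) neqk; case: (k \in Y); nia.
rewrite /square_sum big_distrr -big_split /= (bigD1 k) //.
rewrite [ltnRHS](bigD1 k) //= -addSn leq_add //.
by apply: leq_sum => j _; apply: le_term.
Qed.

Lemma total_le_weighted f e :
  (forall k, 0 < f k)%N -> (total e <= weighted f e)%N.
Proof. by move=> f_gt0; apply: leq_sum => k _; rewrite leq_pmulr. Qed.

Lemma square_sum_le e : (square_sum e <= total e ^ 2)%N.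
Proof.
rewrite expnS expn1 {1}/total big_distrl /=; apply: leq_sum => k _.
by rewrite expnS expn1 leq_mul2l /total (bigD1 k) //= leq_addr orbT.
Qed.

(** Otherwise fewer than [m] exponents are nonzero, each at most [p], and the total is at most
    [p * m]. *)
Lemma exists_large_exponent e p m :
  (#|support_set e| < m)%N -> (p * m < total e)%N -> exists k, (p < e k)%N.
Proof.
move=> lt_m; case: (boolP [exists k, p < e k]%N) => [/existsP // |].
move=> /existsPn le_p; rewrite ltnNge => /negP[].
rewrite /total (bigID (mem (support_set e))) /= [X in (_ + X)%N]big1 => [|k].
  rewrite addn0; apply: (@leq_trans (\sum_(k in support_set e) p)).
    by apply: leq_sum => k _; rewrite leqNgt le_p.
  by rewrite sum_nat_const mulnC leq_mul2l (ltnW lt_m) orbT.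
by rewrite inE -eqn0Ngt => /eqP.
Qed.

End Exponents.

(** * Absorption of products by shorter ones *)

Section AbsorbedProducts.
Variables (S : finComPzSemiRingType) (I : finType).
Variables (c : I -> S) (len : I -> nat) (a : S) (p m : nat).
Hypothesis len_gt0 : forall k, (0 < len k)%N.
Hypothesis S_stable : stable_semiring S p.
Hypothesis card_S : (#|S| < 2 ^ m)%N.
Implicit Types e : I -> nat.

Definition product_weight e : S := a * \prod_k c k ^+ e k.

Lemma product_weight_exchange (X Y : {set I}) e :
    X \subset support_set e ->
  \prod_(k in X) c k = \prod_(k in Y) c k ->
  product_weight (exchange X Y e) = product_weight e.
Proof.
move=> sX eqXY; congr (_ * _).
(* Common part: adding [X] to [e0] restores [e], adding [Y] gives the exchange. *)
pose e0 k := (e k - (k \in X))%N.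
have prodE (Z : {set I}) :
  \prod_k c k ^+ (e0 k + (k \in Z)) =
  (\prod_k c k ^+ e0 k) * \prod_(k in Z) c k.
  rewrite [X in _ * X]big_mkcond -big_split /=; apply: eq_bigr => k _.
  by rewrite exprD; case: (k \in Z).
rewrite prodE -eqXY -prodE; apply: eq_bigr => k _.
by rewrite subnK // in_support.
Qed.

(** Pigeonhole: [Z] has [2 ^ m] subsets, more than [S] has elements. *)
Lemma equal_subproducts (Z : {set I}) : #|Z| = m ->
  exists X Y : {set I}, [/\ X \subset Z, Y \subset Z, X != Y &
    \prod_(k in X) c k = \prod_(k in Y) c k].
Proof.
move=> card_Z.
pose F (X : {set I}) := \prod_(k in X) c k.
case: (boolP (dinjectiveb F (powerset Z))) => [/dinjectiveP inj|/dinjectivePn].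
  have := leq_card_in F _ inj.
  by rewrite card_powerset card_Z leqNgt card_S.
case=> X; rewrite inE => sX [Y]; rewrite !inE => /andP[neq sY] eqF.
by exists X, Y; rewrite eq_sym neq.
Qed.

(* Of the two exchanges of subsets with equal products, one decreases the total
   length, or keeps it and does not decrease the number of factors; convexity
   of the sum of squares breaks ties. *)
Lemma improving_exchange e : (m <= #|support_set e|)%N ->
  exists e', [/\ product_weight e' = product_weight e,
    (total e <= total e' + m)%N &
    (weighted len e' < weighted len e)%N \/
    weighted len e' = weighted len e /\
    ((total e < total e')%N \/
     total e = total e' /\ (square_sum e < square_sum e')%N)].
Proof.
move=> /exists_subset_card[Z sZ card_Z].
have [X [Y [sX sY neqXY eqXY]]] := equal_subproducts card_Z.
have [sXe sYe] := (subset_trans sX sZ, subset_trans sY sZ).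
have := weighted_exchange len Y sXe; have := weighted_exchange len X sYe.
have := total_exchange Y sXe; have := total_exchange X sYe.
have := square_sum_exchange sXe sYe neqXY.
have := subset_leq_card sX; have := subset_leq_card sY; rewrite card_Z.
have := product_weight_exchange sXe eqXY.
have := product_weight_exchange sYe (esym eqXY).
set e1 := exchange X Y e; set e2 := exchange Y X e => w2 w1.
set lX := (\sum_(k in X) _)%N; set lY := (\sum_(k in Y) _)%N.
move=> cY cX sq t2 t1 l2 l1.
have [ltl|gtl|eql] := ltngtP lY lX.
- by exists e1; split=> //; [lia|left; lia].
- by exists e2; split=> //; [lia|left; lia].
have [ltc|gtc|eqc] := ltngtP #|Y| #|X|.
- by exists e2; split=> //; [lia|right; split; [lia|left; lia]].
- by exists e1; split=> //; [lia|right; split; [lia|left; lia]].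
have [lts|ges] := ltnP (square_sum e) (square_sum e1).
- by exists e1; split=> //; [lia|right; split; [lia|right; lia]].
- by exists e2; split=> //; [lia|right; split; [lia|right; lia]].
Qed.

(** [G l] will be the sum over all walks of one length, with [l] shifted by the length of the two
    end pieces. *)
Variable G : nat -> S.
Hypothesis G_ge :
  forall e, natural_le (product_weight e) (G (weighted len e)).

Let H d := \sum_(l < d) G l.

(** Lowering [e k] by 1, ..., p + 1 gives products that sum to a multiple of [geom_sum p (c k)],
    which absorbs the next power of [c k]. *)
Lemma absorbs_large_exponent e k : (p < e k)%N ->
  absorbs (H (weighted len e)) (product_weight e).
Proof.
move=> lt_p.
pose set_k i j := if j == k then i else e j.
pose r := a * \prod_(j | j != k) c j ^+ e j.
have wE i : product_weight (set_k i) = r * c k ^+ i.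
  rewrite /product_weight /r (bigD1 k) //= /set_k eqxx.
  rewrite -mulrA [X in a * X]mulrC; congr (_ * (_ * _)).
  by apply: eq_bigr => j /negbTE->.
have eE : product_weight e = r * c k ^+ e k.
  rewrite -wE; congr (_ * _); apply: eq_bigr => j _.
  by rewrite /set_k; case: eqP => // ->.
have lenE i : weighted len (set_k i) =
    (i * len k + \sum_(j | j != k) e j * len j)%N.
  rewrite /weighted (bigD1 k) //= /set_k eqxx; congr (_ + _)%N.
  by apply: eq_bigr => j /negbTE->.
have lenEe : weighted len e = weighted len (set_k (e k)).
  by apply: eq_bigr => j _; rewrite /set_k; case: eqP => // ->.
pose i0 := (e k - p.+1)%N.
(* Since [len k > 0], each higher power has a larger length, hence uses a new summand of [H]. *)
have partial n : natural_le (\sum_(i < n) r * c k ^+ (i0 + i))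
    (H (weighted len (set_k (i0 + n)%N))).
  elim: n => [|n IHn].
    rewrite big_ord0; exists (H (weighted len (set_k (i0 + 0)%N))).
    by rewrite add0r.
  rewrite big_ord_recr /= -wE.
  apply: (natural_le_trans (natural_leD IHn (G_ge _))).
  have -> d : H d + G d = H d.+1 by rewrite /H big_ord_recr.
  apply: natural_le_sum_ord; rewrite !lenE.
  by have := len_gt0 k; nia.
have := partial p.+1; rewrite lenEe subnK // => le_H.
apply: absorbs_le le_H _; rewrite eE.
have := absorbsM (r * c k ^+ i0) (absorbs_geom_sum (c k) S_stable).
rewrite -[X in absorbs _ X]mulrA -exprD subnK // /geom_sum mulr_sumr.
by under eq_bigr do rewrite -mulrA -exprD.
Qed.

(** Each shortening exchange yields one more copy of the weight and costs at most [m] factors; the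
    spare [p.+1] times [m] factors keep an exponent above [p] once the support is small. *)
Lemma absorbs_or_multiple e t : ((t + p.+1) * m <= total e)%N ->
  natural_le (product_weight e *+ t) (H (weighted len e)) \/
  absorbs (H (weighted len e)) (product_weight e).
Proof.
have m_gt0 : (0 < m)%N.
  by case: m card_S => //; rewrite expn0 ltnS leqn0 => /eqP/card0_eq/(_ 0).
elim: t e => [|t IHt].
  by move=> e _; left; exists (H (weighted len e)); rewrite mulr0n add0r.
(* Exchanges that keep the length terminate: [total] is bounded by the length and [square_sum] by
   its square. *)
apply: (@lex_ind3 _ (weighted len) (fun e => weighted len e - total e)%N
  (fun e => weighted len e ^ 2 - square_sum e)%N) => e IHe le_e.
have [small|/improving_exchange] := ltnP #|support_set e| m.
  have [|k lt_p] := @exists_large_exponent _ e p m small; first by nia.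
  by right; apply: absorbs_large_exponent lt_p.
case=> e' [<- le_m [lt_l | [eq_l tie]]].
  have le_H : natural_le (H (weighted len e').+1) (H (weighted len e)).
    exact: natural_le_sum_ord.
  have [|le_t|abs] := IHt e'; first by nia.
    left; apply: natural_le_trans le_H.
    (* The extra copy is the term of [G] at the length of [e'] itself. *)
    by rewrite mulrSr /H big_ord_recr; apply: natural_leD.
  right; apply: absorbs_le abs; apply: natural_le_trans le_H.
  exact: natural_le_sum_ord.
rewrite -eq_l; apply: IHe; last by lia.
right; split=> //.
have := total_le_weighted e' len_gt0.
have := square_sum_le e'.
by case: tie; nia.
Qed.

(** Case [t = p.+1] above: that many copies absorb one more. *)
Lemma absorbs_product e : ((2 * p.+1) * m <= total e)%N ->
  absorbs (H (weighted len e)) (product_weight e).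
Proof.
rewrite mul2n -addnn => /absorbs_or_multiple[le_H|//].
by apply: absorbs_le le_H _; apply: absorbs_natmul.
Qed.

End AbsorbedProducts.

(** * Walks, their weights and closed subwalks *)

Section Walks.
Variables (S : comPzSemiRingType) (n : nat) (A : 'M[S]_n) (b : 'cV[S]_n).
Implicit Types (i j v : 'I_n) (s : seq 'I_n).

(** The start [i] is not listed in [s], so [size s] counts edges. *)
Fixpoint walk_weight i s : S :=
  if s is j :: s' then A i j * walk_weight j s' else 1.

Lemma walk_weight_cat i s1 s2 :
  walk_weight i (s1 ++ s2) = walk_weight i s1 * walk_weight (last i s1) s2.
Proof. by elim: s1 i => [|j s IHs] i /=; rewrite ?mul1r // IHs mulrA. Qed.

Definition power_apply l : 'cV[S]_n := iter l (mulmx A) b.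

Lemma power_applyS l i :
  power_apply l.+1 i 0 = \sum_j A i j * power_apply l j 0.
Proof. by rewrite /power_apply iterS mxE. Qed.

Lemma naive_eval_sum q : naive_eval A b q = \sum_(l < q) power_apply l.
Proof.
elim: q => [|q IHq]; first by rewrite big_ord0.
rewrite /naive_eval iterS -/(naive_eval A b q) IHq /consequence_op.
by rewrite mulmx_sumr big_ord_recl addrC; congr (_ + _).
Qed.

Lemma walk_weight_le i s :
  natural_le (walk_weight i s * b (last i s) 0) (power_apply (size s) i 0).
Proof.
elim: s i => [|j s IHs] i /=; first by rewrite mul1r; apply: natural_le_refl.
rewrite -mulrA power_applyS; apply: natural_le_trans (natural_leM _ (IHs j)) _.
exact: (natural_le_sum (fun j => A i j * power_apply (size s) j 0)).
Qed.

(** The factor [u] accumulates the edges already peeled off in the induction. *)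
Lemma absorbs_scaled_power_apply x u l i :
  (forall s, size s = l ->
     absorbs x (u * (walk_weight i s * b (last i s) 0))) ->
  absorbs x (u * power_apply l i 0).
Proof.
elim: l i u => [|l IHl] i u abs_walk.
  by have := abs_walk [::] erefl; rewrite mul1r.
rewrite power_applyS mulr_sumr; apply: absorbs_sum => j; rewrite mulrA.
apply: IHl => s size_s; rewrite -mulrA [A i j * _]mulrA.
by apply: (abs_walk (j :: s)); rewrite /= size_s.
Qed.

(** Cut right after each of the first [N] occurrences of [v]. *)
Lemma closed_walks_of_count v s N : (N <= count_mem v s)%N ->
  exists (ls : seq (seq 'I_n)) s1,
    size ls = N /\ s = flatten [seq rcons l v | l <- ls] ++ s1.
Proof.
elim: s N => [|x s IHs] [|N] //=; first by exists [::], [::].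
  by exists [::], (x :: s).
case: eqP => [-> | _] /=.
  rewrite add1n ltnS => /IHs[ls [s1 [size_ls ->]]].
  by exists ([::] :: ls), s1; rewrite /= size_ls.
rewrite add0n => /IHs[[|l ls] [s1 [//= size_ls ->]]].
by exists ((x :: l) :: ls), s1.
Qed.

Lemma frequent_vertex s N : (n * N < size s)%N ->
  exists v, (N < count_mem v s)%N.
Proof.
move=> lt_s; apply/existsP; apply: contraLR lt_s => /existsPn le_N.
have -> : size s = (\sum_v count_mem v s)%N.
  elim: s {le_N} => [|x s IHs] /=; first by rewrite big1.
  rewrite big_split /= -IHs (bigD1 x) //= eqxx big1 ?addn0 // => v.
  by rewrite eq_sym => /negbTE->.
rewrite -leqNgt -[n in (n * N)%N]card_ord -sum_nat_const; apply: leq_sum => v _.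
by rewrite leqNgt le_N.
Qed.

Lemma closed_walk_decomposition i s N : (n * N <= size s)%N ->
  exists v s0 (ls : seq (seq 'I_n)) s1, [/\ last i s0 = v, size ls = N &
    s = s0 ++ flatten [seq rcons l v | l <- ls] ++ s1].
Proof.
(* Counting the start gives more than [n * N] vertices; the first visit to [v] ends [s0]. *)
move=> le_s; have [|v] := @frequent_vertex (i :: s) N; first by [].
move=> /closed_walks_of_count[[|l ls] [s1 [//= [size_ls]]]].
case: l => [|x l] /= [eq_i ->].
  by exists i, [::], ls, s1; rewrite eq_i.
by exists v, (rcons l v), ls, s1; rewrite last_rcons catA.
Qed.

Lemma walk_weight_closed v l s :
  walk_weight v (rcons l v ++ s) = walk_weight v (rcons l v) * walk_weight v s.
Proof. by rewrite walk_weight_cat last_rcons. Qed.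

Lemma walk_weight_closed_nseq v l r s :
  walk_weight v (flatten (nseq r (rcons l v)) ++ s) =
  walk_weight v (rcons l v) ^+ r * walk_weight v s.
Proof.
elim: r => [|r IHr] /=; first by rewrite mul1r.
by rewrite -catA walk_weight_closed IHr exprS mulrA.
Qed.

Lemma walk_weight_repeated v (I : Type) (r : seq I) (l : I -> seq 'I_n) e s :
  walk_weight v
    (flatten [seq flatten (nseq (e k) (rcons (l k) v)) | k <- r] ++ s) =
  (\prod_(k <- r) walk_weight v (rcons (l k) v) ^+ e k) * walk_weight v s.
Proof.
elim: r => [|k r IHr] /=; first by rewrite big_nil mul1r.
by rewrite -catA walk_weight_closed_nseq IHr big_cons mulrA.
Qed.

Lemma size_repeated v (I : Type) (r : seq I) (l : I -> seq 'I_n) e :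
  size (flatten [seq flatten (nseq (e k) (rcons (l k) v)) | k <- r]) =
  (\sum_(k <- r) e k * size (rcons (l k) v))%N.
Proof.
elim: r => [|k r IHr] /=; first by rewrite big_nil.
rewrite size_cat IHr big_cons; congr (_ + _)%N.
by rewrite size_flatten /shape map_nseq sumn_nseq mulnC.
Qed.

Lemma last_repeated v (I : Type) (r : seq I) (l : I -> seq 'I_n) e :
  last v (flatten [seq flatten (nseq (e k) (rcons (l k) v)) | k <- r]) = v.
Proof.
elim: r => //= k r IHr; rewrite last_cat -[RHS]IHr; congr last.
by elim: (e k) => //= t IHt; rewrite last_cat last_rcons.
Qed.

End Walks.

(** * Absorption of long walks and convergence *)

Lemma absorbs_long_walk (S : finComPzSemiRingType) (p m n : nat)
    (A : 'M[S]_n) (b : 'cV[S]_n) (i : 'I_n) (s : seq 'I_n) :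
  stable_semiring S p -> (#|S| < 2 ^ m)%N ->
  size s = (n * (2 * p.+1 * m))%N ->
  absorbs (\sum_(l < size s) power_apply A b l i 0)
          (walk_weight A i s * b (last i s) 0).
Proof.
move=> S_stable card_S size_s.
have [|v [s0 [ls [s1 [last_s0 size_ls def_s]]]]] :=
  @closed_walk_decomposition n i s (2 * p.+1 * m); first by rewrite size_s.
pose l (k : 'I_(size ls)) := nth [::] ls k.
pose walk e := s0 ++
  flatten [seq flatten (nseq (e k) (rcons (l k) v)) | k <- enum 'I_(size ls)]
  ++ s1.
pose len k := size (rcons (l k) v).
pose c k := walk_weight A v (rcons (l k) v).
pose a := walk_weight A i s0 * walk_weight A v s1 * b (last v s1) 0.
pose d := (size s0 + size s1)%N.
have weightE e : walk_weight A i (walk e) * b (last i (walk e)) 0 =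
    product_weight c a e.
  rewrite /walk !last_cat last_s0 last_repeated walk_weight_cat last_s0.
  rewrite walk_weight_repeated big_enum /= /product_weight /a.
  by rewrite -!mulrA; congr (_ * _); rewrite mulrCA; congr (_ * _); rewrite mulrC.
have sizeE e : size (walk e) = (d + weighted len e)%N.
  rewrite /walk !size_cat size_repeated big_enum /= /d /weighted.
  by rewrite addnA addnAC.
(* The given walk uses each closed walk exactly once. *)
pose one := fun _ : 'I_(size ls) => 1%N.
have walk1 : walk one = s.
  rewrite def_s /walk; congr (_ ++ (flatten _ ++ _)).
  transitivity [seq rcons (l k) v | k <- enum 'I_(size ls)].
    by apply: eq_map => k /=; rewrite cats0.
  have eq_ls : [seq l k | k <- enum 'I_(size ls)] = ls.
    rewrite (map_comp (nth [::] ls) val) val_enum_ord -/(mkseq _ _).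
    exact: mkseq_nth.
  by rewrite -[X in _ = map _ X]eq_ls -map_comp.
pose G t := power_apply A b (d + t)%N i 0.
have G_ge e : natural_le (product_weight c a e) (G (weighted len e)).
  by rewrite -weightE /G -sizeE; apply: walk_weight_le.
have le_total : (2 * p.+1 * m <= total one)%N.
  by rewrite /total sum_nat_const card_ord muln1 size_ls.
have len_gt0 k : (0 < len k)%N by rewrite /len size_rcons.
have := absorbs_product len_gt0 S_stable card_S G_ge le_total.
rewrite -weightE walk1; apply: absorbs_le.
have -> : size s = (d + weighted len one)%N by rewrite -sizeE walk1.
(* [H] only covers lengths from [d] on; the shorter ones are added back. *)
rewrite big_split_ord /=.
by exists (\sum_(l0 < d) power_apply A b l0 i 0); rewrite addrC.
Qed.

Lemma naive_eval_stable (S : finComPzSemiRingType) (p m n : nat)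
    (A : 'M[S]_n) (b : 'cV[S]_n) (q := (n * (2 * p.+1 * m))%N) :
  stable_semiring S p -> (#|S| < 2 ^ m)%N ->
  naive_eval A b q.+1 = naive_eval A b q.
Proof.
move=> S_stable card_S; rewrite !naive_eval_sum big_ord_recr /=.
apply/matrixP=> i j; rewrite mxE !summxE (ord1 j).
rewrite -[X in _ + X]mul1r; apply: absorbs_scaled_power_apply => s size_s.
rewrite mul1r -/q -size_s; exact: absorbs_long_walk S_stable card_S size_s.
Qed.

Theorem theorem6 (R : realType) :
  exists C : R, 0 < C /\
    forall (n p L : nat), (1 <= n)%N -> (1 <= p)%N -> (1 <= L)%N ->
    forall S : finComPzSemiRingType, #|S| = L -> stable_semiring S p ->
    forall (A : 'M[S]_n) (b : 'cV[S]_n),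
    exists q : nat,
      q%:R <= C * p%:R * n%:R * ln (L%:R : R) /\
      naive_eval A b q.+1 = naive_eval A b q.
Proof.
have ln2_gt0 : 0 < ln (2 : R) by rewrite ln_gt0 // ltr1n.
(* From p + 1 <= 2p, k + 1 <= 2k and k <= ln L / ln 2, where k is the integer part of the binary
   logarithm of L. *)
exists (8 / ln 2); split; first by rewrite divr_gt0.
move=> n p L n_gt0 p_gt0 L_gt0 S card_S S_stable A b.
have [L_le1|L_gt1] := leqP L 1.
  (* Here ln L = 0 forces q = 0. *)
  have /fintype_le1P trivS : (#|S| <= 1)%N by rewrite card_S.
  exists 0%N; split; last by apply/matrixP=> i j; apply: trivS.
  have -> : L = 1%N by lia.
  by rewrite ln1 mulr0.
pose k := trunc_log 2 L.
have /andP[le_L lt_L] := trunc_log_bounds (ltnSn 1) L_gt0.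
have k_gt0 : (0 < k)%N by rewrite trunc_log_gt0.
exists (n * (2 * p.+1 * k.+1))%N; split; last first.
  by apply: naive_eval_stable S_stable _; rewrite card_S.
have le_ln : k%:R * ln 2 <= ln (L%:R : R).
  rewrite mulrC mulr_natr -lnXn // ler_ln ?posrE ?exprn_gt0 ?ltr0n //.
  by rewrite -natrX ler_nat.
apply: (@le_trans _ _ (8 * p%:R * n%:R * k%:R)).
  by rewrite -!natrM ler_nat; nia.
have -> : 8 / ln 2 * p%:R * n%:R * ln (L%:R : R) =
          8 * p%:R * n%:R * (ln L%:R / ln 2) by lra.
by rewrite ler_wpM2l // ?ler_pdivlMr // !mulr_ge0.
Qed.
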